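(* For $i=1,2$ let $G_i$ be a graph of order $n_i$, and let $n=\max\{n_1,n_2\}$, where $n\ge 2$. If for each $i\in\{1,2\}$ there exists a subset $U_i\subseteq V(G_i)$ with $|U_i|\le 27\sqrt[3]{n}$ such that $\Delta(G_i-U_i)\le 54\,\frac{\sqrt[3]{n}}{\log^{3} n}$, then $R(G_1,G_2)\le 2^{250\sqrt[3]{n}}$.
   Context: Graphs are finite and simple. For graphs $G_1,G_2$, the Ramsey number $R(G_1,G_2)$ is the smallest positive integer $N$ such that every blue-red edge coloring of the complete graph $K_N$ contains a blue subgraph isomorphic to $G_1$ or a red subgraph isomorphic to $G_2$. $\log$ denotes the logarithm in base $2$, and $\log^3 n=(\log n)^3$. $\Delta(\cdot)$ denotes maximum degree, and $G-U$ is the graph obtained from $G$ by deleting the vertices in $U$. *)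

(* Defs.v *)
From mathcomp Require Import all_boot all_order all_algebra.
From mathcomp Require Import reals exp.

Set Implicit Arguments.
Unset Strict Implicit.
Unset Printing Implicit Defensive.

Import Order.TTheory GRing.Theory Num.Theory.

Record sgraph := SGraph {
  vertex :> finType;
  edge : rel vertex;
  edge_sym : symmetric edge;
  edge_irrefl : irreflexive edge }.

Arguments edge : clear implicits.

Definition max_degree (G : sgraph) : nat :=
  \max_(x : G) #|[set y | edge G x y]|.

Section DeleteVertices.
Variables (G : sgraph) (U : {set G}).

Definition del_edge : rel {x : G | x \notin U} :=
  fun x y => edge G (val x) (val y).

Lemma del_edge_sym : symmetric del_edge.
Proof. by move=> x y; apply: edge_sym. Qed.

Lemma del_edge_irrefl : irreflexive del_edge.
Proof. by move=> x; apply: edge_irrefl. Qed.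

Definition del_vertices : sgraph := SGraph del_edge_sym del_edge_irrefl.

End DeleteVertices.

(* H has a (not necessarily induced) subgraph isomorphic to G: the image of an
   injective map that sends edges of G to edges of H. *)
Definition contains_copy (H G : sgraph) : bool :=
  [exists f : {ffun G -> H},
    injectiveb f && [forall x, forall y, edge G x y ==> edge H (f x) (f y)]].

(* A two-colouring of the edges of the complete graph on 'I_N colours the
   two-element subsets of 'I_N, true being blue and false being red; its values
   on the other subsets are never used. *)
Definition coloring (N : nat) := {ffun {set 'I_N} -> bool}.

Section ColorClass.
Variables (N : nat) (c : coloring N) (b : bool).

Definition color_edge : rel 'I_N :=
  fun x y => (x != y) && (c [set x; y] == b).

Lemma color_edge_sym : symmetric color_edge.
Proof. by move=> x y; rewrite /color_edge eq_sym setUC. Qed.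

Lemma color_edge_irrefl : irreflexive color_edge.
Proof. by move=> x; rewrite /color_edge eqxx. Qed.

Definition color_graph : sgraph := SGraph color_edge_sym color_edge_irrefl.

End ColorClass.

Definition blue_graph (N : nat) (c : coloring N) : sgraph := color_graph c true.
Definition red_graph (N : nat) (c : coloring N) : sgraph := color_graph c false.

Definition arrows (G1 G2 : sgraph) (N : nat) : bool :=
  [forall c : coloring N,
    contains_copy (blue_graph c) G1 || contains_copy (red_graph c) G2].

Lemma ramsey_seq (T : eqType) (e : rel T) (a b : nat) (s : seq T) :
  symmetric e -> uniq s -> 2 ^ (a + b) <= size s ->
  exists2 t : seq T, uniq t &
    (size t = a /\ {in t &, forall x y, x != y -> e x y}) \/
    (size t = b /\ {in t &, forall x y, x != y -> ~~ e x y}).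
Proof.
move=> esym us hs.
suff: exists2 t : seq T, uniq t & {subset t <= s} /\ (
    (size t = a /\ {in t &, forall x y, x != y -> e x y}) \/
    (size t = b /\ {in t &, forall x y, x != y -> ~~ e x y})).
  by case=> t ut [_ ht]; exists t.
move: us hs; have [m] := ubnP (a + b).
elim: m a b s => // m IH [|a] [|b] s lem us hs.
1-3: by exists [::] => //; split=> //; (by left) || (by right).
case: s us hs => [_|x s /= /andP[xs us] hs]; first by rewrite leqNgt expn_gt0.
have hc : size (filter (e x) s) + size (filter (predC (e x)) s) = size s.
  by rewrite !size_filter count_predC.
have [h|h] := leqP (2 ^ (a + b.+1)) (size (filter (e x) s)).
  have [|t ut [ts ht]] := IH a b.+1 (filter (e x) s) _ (filter_uniq _ us) h.
    by rewrite addSn in lem.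
  have tx y : y \in t -> e x y by move/ts; rewrite mem_filter => /andP[].
  have tss y : y \in t -> y \in s by move/ts; rewrite mem_filter => /andP[].
  case: ht => [[st ct]|ht]; last first.
    by exists t => //; split; [move=> y /tss; rewrite inE orbC => -> | right].
  exists (x :: t); first by rewrite /= ut andbT; apply: contra xs => /tss.
  split; first by move=> y; rewrite !inE => /orP[->//|/tss->]; rewrite orbT.
  left; split; first by rewrite /= st.
  move=> y z; rewrite !inE => /orP[/eqP->|yt] /orP[/eqP->|zt].
  - by rewrite eqxx.
  - by move=> _; apply: tx.
  - by move=> _; rewrite esym; apply: tx.
  - exact: ct.
have h' : 2 ^ (a.+1 + b) <= size (filter (predC (e x)) s).
  rewrite addSnnS -(leq_add2l (2 ^ (a + b.+1))).
  move: hs; rewrite addSn expnS mul2n -addnn -hc => /leq_trans; apply.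
  by rewrite -addSn leq_add2r.
have [|t ut [ts ht]] := IH a.+1 b (filter (predC (e x)) s) _ (filter_uniq _ us) h'.
  by rewrite addnS in lem.
have tx y : y \in t -> ~~ e x y by move/ts; rewrite mem_filter => /andP[].
have tss y : y \in t -> y \in s by move/ts; rewrite mem_filter => /andP[].
case: ht => [ht|[st ct]].
  by exists t => //; split; [move=> y /tss; rewrite inE orbC => -> | left].
exists (x :: t); first by rewrite /= ut andbT; apply: contra xs => /tss.
split; first by move=> y; rewrite !inE => /orP[->//|/tss->]; rewrite orbT.
right; split; first by rewrite /= st.
move=> y z; rewrite !inE => /orP[/eqP->|yt] /orP[/eqP->|zt].
- by rewrite eqxx.
- by move=> _; apply: tx.
- by move=> _; rewrite esym; apply: tx.
- exact: ct.
Qed.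

Lemma contains_copy_clique (H G : sgraph) (t : seq H) :
  uniq t -> size t = #|G| -> {in t &, forall x y, x != y -> edge H x y} ->
  contains_copy H G.
Proof.
move=> ut st ct.
have ht (x : G) : enum_rank x < size t by rewrite st.
case: (pickP (fun _ : G => true)) => [g _|G0]; last first.
  apply/existsP; exists (ffun0 (eq_card0 G0)).
  by apply/andP; split; [apply/injectiveP|apply/forallP] => x; have := G0 x.
have x0 : H by have := ht g; case: (t) => // y.
pose f := [ffun x : G => nth x0 t (enum_rank x)].
have finj : injective f.
  move=> x y; rewrite !ffunE => /eqP; rewrite nth_uniq // => /eqP /val_inj.
  exact: enum_rank_inj.
apply/existsP; exists f; apply/andP; split; first exact/injectiveP.
apply/forallP => x; apply/forallP => y; apply/implyP => exy.
apply: ct; rewrite ?ffunE ?mem_nth //.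
rewrite -!(ffunE (fun x : G => nth x0 t (enum_rank x))) (inj_eq finj).
by apply: contraTneq exy => ->; rewrite edge_irrefl.
Qed.

Lemma ramsey_exists (G1 G2 : sgraph) : exists N, (0 < N) && arrows G1 G2 N.
Proof.
exists (2 ^ (#|G1| + #|G2|)); rewrite expn_gt0 /=; apply/forallP => c.
set N := 2 ^ _ in c *.
have [|t ut [[st ct]|[st ct]]] := @ramsey_seq _ (edge (blue_graph c))
  #|G1| #|G2| (enum 'I_N) (@edge_sym _) (enum_uniq _).
- by rewrite size_enum_ord.
- by rewrite (contains_copy_clique ut st ct).
- rewrite orbC (@contains_copy_clique (red_graph c) G2 t) //.
  move=> x y xt yt xy; move: (ct x y xt yt xy).
  by rewrite /= /color_edge xy /= eqb_id eqbF_neg.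
Qed.

Definition ramsey_number (G1 G2 : sgraph) : nat := ex_minn (ramsey_exists G1 G2).

Local Open Scope ring_scope.

Definition log2 (R : realType) (x : R) : R := ln x / ln 2.

Definition cbrt (R : realType) (x : R) : R := x `^ (3%:R^-1).

(* Main.v *)
Require Import Defs.
From mathcomp Require Import all_boot all_order all_algebra.
From mathcomp Require Import reals exp.
From mathcomp Require Import zify ring lra.

(** Write k for the cube root of n and L for the base-2 logarithm of n.

    The classical neighbourhood-chasing argument for Ramsey's theorem loses a
    factor 2 per step, so after at most |U1| + |U2| <= 54 k steps it has found
    either a blue clique K of size |U1| all of whose edges to a large set B are
    blue, or the same in red with |U2| ([monochromatic_joined_clique]).  The
    two cases are symmetric.  In the blue one a blue copy of G1 - U1 inside B
    extends to a blue copy of G1 by placing U1 on K, whatever the edges of G1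
    at U1 are ([contains_copy_joined]).

    It remains to see that, if B holds no blue copy of the graph H = G1 - U1 of
    maximum degree at most d, then B holds a red clique on n vertices, hence a
    red copy of G2.  Embedding H greedily works as long as blue has density at
    least 1 / q, in a one-sided sense, between any two large subsets
    ([embeds_dense]).  When it fails there are large sets A and C such that
    each vertex of A is red to all but a fraction 1 / q of C.  A red clique in
    A of size at most q / 2 is then completely red to half of C, where a second
    clique of the same size can be found: the size doubles each time
    ([embeds_or_clique]).  With q = 2 ^ t and t the upper integer part of L,
    t rounds give n vertices, each round costing a factor 2 q ^ d (d + 1).

    Altogether, N = 2 ^ E vertices suffice with
    E = |U1| + |U2| + t (t d + d + 1) + t, where t <= L + 1.  Since d is at
    most 54 k / L ^ 3, the terms in d add up to O(k / L), and the remaining 2 t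
    is O(k); the constants leave E <= 250 k ([embed_or_clique_bound_powR]). *)

Set Implicit Arguments.
Unset Strict Implicit.

(** * Embeddings and cliques inside a set of vertices *)

(** The relation e is an arbitrary one, possibly with loops, so that it can be
    the complement of a colour class. *)
Definition embeds (G : sgraph) (T : finType) (e : rel T) (S : {set T}) :=
  exists f : G -> T, [/\ injective f, forall x, f x \in S &
                      forall x y, edge G x y -> e (f x) (f y)].

Definition clique (T : finType) (r : rel T) (K : {set T}) :=
  {in K &, forall x y, x != y -> r x y}.

(** When r is irreflexive, K and B are automatically disjoint. *)
Definition joined_clique (T : finType) (r : rel T) (S : {set T}) (a M : nat) :=
  exists K B : {set T},
    [/\ K :|: B \subset S, #|K| = a, M <= #|B|, clique r K
      & {in K & B, forall x y, r x y}].

Lemma clique_setU1 (T : finType) (r : rel T) (x : T) (K : {set T}) :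
  symmetric r -> clique r K -> {in K, forall y, r x y} -> clique r (x |: K).
Proof.
move=> rsym Kr xr y z; rewrite !inE => /orP[/eqP->|yK] /orP[/eqP->|zK].
- by rewrite eqxx.
- by move=> _; apply: xr.
- by move=> _; rewrite rsym; apply: xr.
- exact: Kr.
Qed.

Lemma card_bigcup_leq (I T : finType) (A : {set I}) (B : I -> {set T}) m :
  {in A, forall i, #|B i| <= m} -> #|\bigcup_(i in A) B i| <= #|A| * m.
Proof.
move=> Bm; rewrite -sum_nat_const.
apply: leq_trans (leq_sum _ Bm).
elim/big_rec2: _ => [|i u X _ le]; first by rewrite cards0.
by rewrite (leq_trans (leq_card_setU _ _)) // leq_add2l.
Qed.

(** * Monochromatic cliques joined to a large set *)

Lemma joined_clique0 (T : finType) (r : rel T) (S : {set T}) M :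
  M <= #|S| -> joined_clique r S 0 M.
Proof.
move=> MS; exists set0, S; split=> //; rewrite ?set0U ?cards0 //.
  by move=> y z; rewrite inE.
by move=> y z; rewrite inE.
Qed.

Lemma joined_clique_sub (T : finType) (r : rel T) (S S' : {set T}) a M :
  S \subset S' -> joined_clique r S a M -> joined_clique r S' a M.
Proof.
move=> SS' [K [B [KBS cK cB Kr KB]]]; exists K, B; split=> //.
exact: subset_trans SS'.
Qed.

(** One step of the Ramsey recursion: inside the r-neighbourhood of x, the
    vertex x itself can be added to the clique. *)
Lemma joined_cliqueS (T : finType) (r : rel T) (S : {set T}) (x : T) a M :
  symmetric r -> irreflexive r -> x \in S ->
  joined_clique r [set y in S | r x y] a M -> joined_clique r S a.+1 M.
Proof.
move=> rs ri xS [K [B [KBS cK cB Kr KB]]].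
have xKB y : y \in K :|: B -> r x y.
  by move=> /(subsetP KBS); rewrite inE => /andP[].
exists (x |: K), B; split=> //.
- rewrite -setUA subUset sub1set xS (subset_trans KBS) //.
  by apply/subsetP => y; rewrite inE => /andP[].
- rewrite cardsU1 cK; case: (boolP (x \in K)) => // xK.
  by have := xKB x; rewrite inE xK ri => /(_ isT).
- by apply: clique_setU1 => // y yK; apply: xKB; rewrite inE yK.
- move=> y z; rewrite in_setU1 => /orP[/eqP-> zB|yK zB]; last exact: KB.
  by apply: xKB; rewrite inE zB orbT.
Qed.

(** Each vertex is adjacent to at least half of the others in r1 or in r2;
    recursing into that neighbourhood lowers a or b by one.  The recursion stops
    as soon as one of a and b is exhausted, and what is left of S then serves as
    B. *)
Lemma monochromatic_joined_clique (T : finType) (r1 r2 : rel T) (a b M : nat)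
    (S : {set T}) :
  symmetric r1 -> symmetric r2 -> irreflexive r1 -> irreflexive r2 ->
  (forall x y, x != y -> r1 x y || r2 x y) ->
  0 < M -> 2 ^ (a + b) * M <= #|S| ->
  joined_clique r1 S a M \/ joined_clique r2 S b M.
Proof.
move=> s1 s2 i1 i2 cov M0.
have small c (X : {set T}) : 2 ^ c * M <= #|X| -> M <= #|X|.
  by apply: leq_trans; rewrite leq_pmull // expn_gt0.
have [m] := ubnP (a + b); elim: m a b S => // m IH [|a] [|b] S lem hS.
- by left; apply/joined_clique0/small/hS.
- by left; apply/joined_clique0/small/hS.
- by right; apply/joined_clique0/small/hS.
have /card_gt0P[x xS] : 0 < #|S| by apply: leq_trans (small _ _ hS).
have nS : #|S :\ x| <= #|[set y in S | r1 x y]| + #|[set y in S | r2 x y]|.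
  apply: leq_trans (leq_card_setU _ _); apply/subset_leq_card/subsetP => y.
  by rewrite !inE -andb_orr => /andP[yx ->] /=; apply: cov; rewrite eq_sym.
have cS := cardsD1 x S; rewrite xS in cS.
have sub (r : rel T) : [set y in S | r x y] \subset S.
  by apply/subsetP => y; rewrite inE => /andP[].
have e0 : 2 ^ (a.+1 + b.+1) * M = 2 * (2 ^ (a + b.+1) * M).
  by rewrite addSn expnS mulnA.
have [big1|sm1] := leqP (2 ^ (a + b.+1) * M) #|[set y in S | r1 x y]|.
  have [|J|J] := IH a b.+1 _ _ big1; first by lia.
    by left; apply: joined_cliqueS xS J.
  by right; apply: joined_clique_sub J.
have big2 : 2 ^ (a.+1 + b) * M <= #|[set y in S | r2 x y]|.
  by rewrite addSnnS; lia.
have [|J|J] := IH a.+1 b _ _ big2; first by lia.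
  by left; apply: joined_clique_sub J.
by right; apply: joined_cliqueS xS J.
Qed.

(** * Bounded-degree graphs against cliques *)

(** Vertices of G are placed one at a time.  An unplaced w keeps the set C of
    its possible images, the vertices of S adjacent to the images of all placed
    neighbours of w.  A new vertex v is placed so that no C shrinks by more
    than a factor q: the density hypothesis bars at most r images for each of
    the at most d unplaced neighbours of v, and fewer than r images are already
    taken.  As w has at most d neighbours, its C never drops below
    #|S| / q ^ d, which by assumption is at least (d + 1) r. *)
Lemma embeds_dense (G : sgraph) (T : finType) (e : rel T) (S : {set T})
    (d q r : nat) :
  symmetric e -> max_degree G <= d -> #|G| <= r -> 0 < r -> 0 < q ->
  q ^ d * (d.+1 * r) <= #|S| ->
  (forall A B : {set T}, A \subset S -> B \subset S -> r <= #|A| -> r <= #|B| ->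
     exists2 x, x \in A & #|B| <= q * #|[set y in B | e x y]|) ->
  embeds G e S.
Proof.
move=> es degG Gr r0 q0 hS dense.
pose C (P : {set G}) (f : G -> T) w :=
  [set y in S | [forall p in P, edge G p w ==> e (f p) y]].
pose nb (P : {set G}) w := #|[set p in P | edge G p w]|.
have deg (P : {set G}) w : nb P w <= d.
  apply: leq_trans degG.
  apply: leq_trans (leq_bigmax_cond (F := fun x => #|[set y | edge G x y]|) w isT).
  by apply/subset_leq_card/subsetP => y; rewrite !inE edge_sym => /andP[].
have CS P f w : C P f w \subset S by apply/subsetP => y; rewrite inE => /andP[].
have [x0 x0S] : exists x0, x0 \in S.
  by apply/card_gt0P/(leq_trans _ hS); rewrite !muln_gt0 expn_gt0 q0.
have step k : k <= #|G| -> exists (P : {set G}) (f : G -> T),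
    [/\ #|P| = k, {in P, forall x, f x \in S}, {in P &, injective f},
        {in P &, forall x y, edge G x y -> e (f x) (f y)}
      & forall w, w \notin P -> #|S| <= q ^ nb P w * #|C P f w|].
  elim: k => [_|k IH kG].
    exists set0, (fun=> x0); split; rewrite ?cards0 //.
    - by move=> x y; rewrite inE.
    - by move=> x y; rewrite inE.
    move=> w _; rewrite (_ : C _ _ _ = S) ?leq_pmull ?expn_gt0 ?q0 //.
    apply/setP => y; rewrite inE; case: (y \in S) => //=.
    by apply/forall_inP => p; rewrite inE.
  have [P [f [cP fS finj fe fC]]] := IH (ltnW kG).
  have [v vP] : exists v, v \in ~: P.
    by apply/card_gt0P; have := cardsC P; lia.
  rewrite inE in vP.
  have Cbig w : w \notin P -> d.+1 * r <= #|C P f w|.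
    move=> wP; rewrite -(@leq_pmul2l (q ^ d)) ?expn_gt0 ?q0 //.
    apply: (leq_trans hS); apply: (leq_trans (fC w wP)).
    by rewrite leq_mul2r leq_pexp2l ?orbT // deg.
  (* Bad w: the images of v that would shrink the candidates of w too much. *)
  pose N := [set w | edge G v w].
  pose Bad w := [set x in C P f v |
    q * #|[set y in C P f w | e x y]| < #|C P f w|].
  have Bad_small w : w \in N :\: P -> #|Bad w| <= r.
    rewrite !inE => /andP[wP _]; rewrite leqNgt; apply/negP => Br.
    have [||||x] := dense (Bad w) (C P f w) => //.
    - by apply: subset_trans (CS P f v); apply/subsetP => y; rewrite inE => /andP[].
    - exact: ltnW.
    - by apply: leq_trans (Cbig w wP); rewrite leq_pmull.
    by rewrite inE => /andP[_]; rewrite ltnNge => /negP.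
  have cN : #|N :\: P| <= d.
    apply: leq_trans (deg setT v); apply/subset_leq_card/subsetP => y.
    by rewrite !inE edge_sym => /andP[].
  pose X := f @: P :|: \bigcup_(w in N :\: P) Bad w.
  have cX : #|X| < #|C P f v|.
    apply: leq_trans (Cbig v vP); rewrite mulSn.
    have le1 := leq_card_setU (f @: P) (\bigcup_(w in N :\: P) Bad w).
    have le2 := leq_imset_card f P.
    have le3 := card_bigcup_leq Bad_small.
    have le4 : #|N :\: P| * r <= d * r by rewrite leq_mul2r cN orbT.
    apply: leq_ltn_trans le1 _; rewrite -addSn.
    by apply: leq_add; [rewrite (leq_ltn_trans le2) // cP (leq_trans kG)|exact: leq_trans le4].
  have [x xC xX] : exists2 x, x \in C P f v & x \notin X.
    apply/subsetPn; apply: contraL cX => /subset_leq_card; rewrite -leqNgt //.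
  move: xX; rewrite inE negb_or => /andP[xfP xBad].
  move: (xC); rewrite inE => /andP[xS /forall_inP xe].
  pose f' z := if z == v then x else f z.
  have f'v : f' v = x by rewrite /f' eqxx.
  have f'P z : z \in P -> f' z = f z.
    by rewrite /f'; case: eqP => // -> vP'; rewrite vP' in vP.
  exists (v |: P), f'; split.
  - by rewrite cardsU1 vP cP.
  - by move=> z; rewrite in_setU1 => /orP[/eqP->|zP]; rewrite ?f'v ?f'P ?fS.
  - move=> y z; rewrite !in_setU1 => /orP[/eqP->|yP] /orP[/eqP->|zP] //.
    + rewrite f'v f'P // => xz; case/negP: xfP; apply/imsetP; by exists z.
    + rewrite f'v f'P // => xz; case/negP: xfP; apply/imsetP; by exists y.
    + rewrite !f'P //; exact: finj.
  - move=> y z; rewrite !in_setU1 => /orP[/eqP->|yP] /orP[/eqP->|zP].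
    + by rewrite edge_irrefl.
    + by rewrite f'v f'P // edge_sym es => /(implyP (xe z zP)).
    + by rewrite f'v f'P // => /(implyP (xe y yP)).
    + by rewrite !f'P //; apply: fe.
  - move=> w; rewrite in_setU1 negb_or => /andP[wv wP].
    have C' : C (v |: P) f' w =
        [set y in C P f w | edge G v w ==> e x y].
      apply/setP => y; rewrite !inE -andbA; congr (_ && _).
      apply/forall_inP/andP => [h|[/forall_inP h1 h2] p].
        split; last by have := h v (setU11 _ _); rewrite f'v.
        by apply/forall_inP => p pP; rewrite -f'P //; apply: h; rewrite setU1r.
      by rewrite in_setU1 => /orP[/eqP->|pP]; rewrite ?f'v ?f'P ?h1.
    have [vw|vw] := boolP (edge G v w); last first.
      have -> : nb (v |: P) w = nb P w.
        apply: eq_card => p; rewrite !inE; case: eqP => //= ->.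
        by rewrite (negPf vw) andbF.
      suff -> : C (v |: P) f' w = C P f w by apply: fC.
      by rewrite C'; apply/setP => y; rewrite inE (negPf vw) andbT.
    have -> : nb (v |: P) w = (nb P w).+1.
      have -> : nb (v |: P) w = #|v |: [set p in P | edge G p w]|.
        by apply: eq_card => p; rewrite !inE; case: eqP => //= ->.
      by rewrite cardsU1 inE (negPf vP).
    have xw : x \notin Bad w.
      by apply: contra xBad => xw; apply/bigcupP; exists w; rewrite // !inE wP.
    move: xw; rewrite inE xC /= -leqNgt => xw.
    rewrite C' vw /= expnSr -mulnA.
    by apply: leq_trans (fC w wP) _; rewrite leq_mul2l xw orbT.
have [P [f [cP fS finj fe _]]] := step _ (leqnn _).
have PT x : x \in P.
  suff -> : P = setT by rewrite inE.
  by apply/eqP; rewrite eqEcard subsetT cardsT cP leqnn.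
by exists f; split=> [x y|x|x y]; [exact: finj|exact: fS|exact: fe].
Qed.

(** Doubling a clique: failure of [embeds_dense] with q = 2 ^ t gives A and B
    with every vertex of A non-adjacent in r to fewer than #|B| / q vertices of
    B.  A clique K of size 2 ^ j <= q / 2 in A leaves at least half of B fully
    adjacent to K, and a second clique of size 2 ^ j found there completes K.
    A and B may overlap: since ~~ r x x holds at every x, discarding from B the
    non-neighbours of the vertices of K also discards K itself. *)
Lemma embeds_or_clique (H : sgraph) (T : finType) (r : rel T) (d s t j : nat)
    (S : {set T}) :
  symmetric r -> irreflexive r -> max_degree H <= d -> #|H| <= s -> 0 < s ->
  j <= t -> (2 * (2 ^ (t * d) * d.+1)) ^ j * s <= #|S| ->
  embeds H (fun x y => ~~ r x y) S \/
  exists K : {set T}, [/\ K \subset S, #|K| = 2 ^ j & clique r K].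
Proof.
move=> rs ri degH Hs s0; set c := 2 * _.
have c0 : 0 < c by rewrite !muln_gt0 expn_gt0.
elim: j S => [|j IH] S jt hS.
  have /card_gt0P[x xS] : 0 < #|S| by apply: leq_trans hS; rewrite mul1n.
  right; exists [set x]; rewrite sub1set cards1; split=> // y z.
  by rewrite !inE => /eqP-> /eqP->; rewrite eqxx.
pose N (B : {set T}) x := [set y in B | ~~ r x y].
(* The factor 2 makes up for the half of B that gets lost. *)
set r0 := 2 * (c ^ j * s).
have r0s : s <= c ^ j * s by rewrite leq_pmull ?expn_gt0 ?c0.
have [|] := boolP [exists A : {set T}, [exists B : {set T},
   [&& A \subset S, B \subset S, r0 <= #|A|, r0 <= #|B| &
     [forall x in A, 2 ^ t * #|N B x| < #|B|]]]].
  case/existsP => A /existsP[B /and5P[AS BS Ar Br /forall_inP sparse]].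
  have [|emb|[K [KA cK Kr]]] := IH A (ltnW jt); first by rewrite /r0 in Ar; lia.
    by left; case: emb => f [f1 f2 f3]; exists f; split=> // x; apply/(subsetP AS).
  pose B' := B :\: \bigcup_(x in K) N B x.
  have B'r x y : x \in K -> y \in B' -> r x y.
    move=> xK; rewrite in_setD => /andP[yN yB]; apply: contraR yN => rxy.
    by apply/bigcupP; exists x; rewrite // inE yB.
  have B'B : B' \subset B by apply: subsetDl.
  have halfB : #|\bigcup_(x in K) N B x| <= #|B| %/ 2.
    have small : {in K, forall x, #|N B x| <= #|B| %/ 2 ^ t}.
      move=> x xK; rewrite leq_divRL ?expn_gt0 // mulnC ltnW // sparse //.
      exact: (subsetP KA).
    apply: leq_trans (card_bigcup_leq small) _.
    rewrite cK leq_divRL // mulnAC -expnSr.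
    apply: leq_trans (leq_trunc_div #|B| (2 ^ t)).
    by rewrite mulnC leq_mul2l leq_pexp2l ?orbT.
  have B'big : c ^ j * s <= #|B'|.
    have := cardsD B (\bigcup_(x in K) N B x).
    have := subset_leq_card (subsetIr B (\bigcup_(x in K) N B x)).
    rewrite -/B' /r0 in Br *; lia.
  have [//|emb|[K' [KB' cK' K'r]]] := IH B' (ltnW jt) => //.
    left; case: emb => f [f1 f2 f3]; exists f; split=> // x.
    by apply/(subsetP BS)/(subsetP B'B).
  right; exists (K :|: K'); split.
  - rewrite subUset (subset_trans KA AS) /=.
    exact: subset_trans (subset_trans KB' B'B) BS.
  - rewrite cardsU cK cK' (_ : K :&: K' = set0) ?cards0 ?subn0 ?addnn -?mul2n -?expnS //.
    apply/setP => y; rewrite !inE; apply/negP => /andP[yK /(subsetP KB') yB'].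
    by have := B'r y y yK yB'; rewrite ri.
  - move=> x y; rewrite !inE => /orP[xK|xK] /orP[yK|yK] xy.
    + exact: Kr.
    + by apply: B'r => //; apply: (subsetP KB').
    + by rewrite rs; apply: B'r => //; apply: (subsetP KB').
    + exact: K'r.
move=> nsparse; left; apply: (@embeds_dense _ _ _ _ d (2 ^ t) r0) => //.
- by move=> x y; rewrite rs.
- by rewrite /r0; lia.
- by rewrite /r0; lia.
- by rewrite expn_gt0.
- apply: leq_trans hS; rewrite -expnM expnS /r0 /c; nia.
move=> A B AS BS Ar Br; apply/exists_inP.
apply: contraR nsparse; rewrite negb_exists => /forallP h.
apply/existsP; exists A; apply/existsP; exists B; rewrite AS BS Ar Br /=.
apply/forall_inP => x xA; have := h x; rewrite xA /= -ltnNge; exact.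
Qed.

(** The order required by [embeds_or_clique] for n vertices, with t = j the
    least exponent such that n <= 2 ^ t. *)
Definition embed_or_clique_bound (d n : nat) : nat :=
  (2 * (2 ^ (up_log 2 n * d) * d.+1)) ^ up_log 2 n * n.

Lemma embed_or_clique_bound_gt0 (d n : nat) :
  0 < n -> 0 < embed_or_clique_bound d n.
Proof. by move=> n0; rewrite !muln_gt0 n0 !expn_gt0 !muln_gt0 expn_gt0. Qed.

(** * Gluing the two parts of the graph *)

Lemma contains_copy_joined (G : sgraph) (T : finType) (r : rel T)
    (rs : symmetric r) (ri : irreflexive r) (U : {set G}) (K B : {set T}) :
  #|K| = #|U| -> clique r K -> {in K & B, forall x y, r x y} ->
  embeds (del_vertices U) r B -> contains_copy (SGraph rs ri) G.
Proof.
move=> cKU Kr KB [g [ginj gB ge]].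
have [a _|G0] := pickP (fun _ : G => true); last first.
  by apply: (@contains_copy_clique (SGraph rs ri) G [::]); rewrite ?eq_card0.
have [x0 _] : exists x0 : T, true.
  have [aU|aU] := boolP (a \in U); last by exists (g (Sub a aU)).
  have /card_gt0P[x _] : 0 < #|K| by rewrite cKU; apply/card_gt0P; exists a.
  by exists x.
(* The vertices of U are matched with those of K by their ranks; x0 is a
   default value that is never reached on U. *)
pose k x := nth x0 (enum K) (index x (enum U)).
have idx x : x \in U -> index x (enum U) < size (enum K).
  by move=> xU; rewrite -cardE cKU cardE index_mem mem_enum.
have kK x : x \in U -> k x \in K.
  by move=> xU; rewrite -mem_enum mem_nth ?idx.
have kinj : {in U &, injective k}.
  move=> x y xU yU /eqP; rewrite nth_uniq ?idx ?enum_uniq // => /eqP eq_i.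
  by rewrite -[x](nth_index a (s := enum U)) ?mem_enum // eq_i nth_index ?mem_enum.
pose f : {ffun G -> T} :=
  [ffun x => if (insub x : option {x : G | x \notin U}) is Some x' then g x' else k x].
have fU x : x \in U -> f x = k x.
  by move=> xU; rewrite ffunE insubF // xU.
have fN x (xU : x \notin U) : f x = g (Sub x xU).
  by rewrite ffunE insubT.
have KnB x : x \in K -> x \notin B.
  by move=> xK; apply/negP => xB; have := KB x x xK xB; rewrite ri.
have kg x y : x \in U -> k x <> g y.
  by move=> /kK /KnB /negP kB kg; apply: kB; rewrite kg.
apply/existsP; exists f; apply/andP; split.
  apply/injectiveP => x y.
  have [xU|xU] := boolP (x \in U); have [yU|yU] := boolP (y \in U).
  - by rewrite !fU //; apply: kinj.
  - by rewrite (fU x xU) fN => /(kg _ _ xU).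
  - by rewrite (fU y yU) fN => /esym/(kg _ _ yU).
  - by rewrite !fN => /ginj/(congr1 val).
apply/forallP => x; apply/forallP => y; apply/implyP => xy /=.
have [xU|xU] := boolP (x \in U); have [yU|yU] := boolP (y \in U).
- rewrite !fU //; apply: Kr; rewrite ?kK //.
  by apply: contraTneq xy => /kinj-> //; rewrite edge_irrefl.
- by rewrite (fU x xU) fN KB ?kK.
- by rewrite (fU y yU) fN rs KB ?kK.
- by rewrite !fN; apply: ge.
Qed.

(** In B either G1 - U embeds in the complement of r2, hence in r1 because
    distinct vertices have distinct images, or there is an r2-clique so large
    that it contains every graph on at most n vertices. *)
Lemma contains_copy_of_joined_clique (G1 G2 : sgraph) (T : finType)
    (r1 r2 : rel T) (s1 : symmetric r1) (s2 : symmetric r2)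
    (i1 : irreflexive r1) (i2 : irreflexive r2) (U : {set G1}) (S : {set T})
    (d n : nat) :
  (forall x y, x != y -> r1 x y || r2 x y) ->
  0 < n -> #|G1| <= n -> #|G2| <= n -> max_degree (del_vertices U) <= d ->
  joined_clique r1 S #|U| (embed_or_clique_bound d n) ->
  contains_copy (SGraph s1 i1) G1 || contains_copy (SGraph s2 i2) G2.
Proof.
move=> cov n0 G1n G2n degU [K [B [KBS cK cB Kr KB]]].
have delUn : #|del_vertices U| <= n.
  by rewrite (leq_trans _ G1n) // card_sub max_card.
have [[f [finj fB fe]]|[Q [QB cQ Qr]]] :=
    embeds_or_clique s2 i2 degU delUn n0 (leqnn _) cB.
  rewrite (@contains_copy_joined G1 T r1 s1 i1 U K B) //.
  exists f; split=> // x y xy.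
  have /cov : f x != f y.
    by rewrite (inj_eq finj); apply: contraTneq xy => ->; rewrite edge_irrefl.
  by rewrite (negPf (fe _ _ xy)) orbF.
rewrite orbC (@contains_copy_clique (SGraph s2 i2) G2 (take #|G2| (enum Q))) //.
- by rewrite take_uniq ?enum_uniq.
- rewrite size_takel // -cardE cQ (leq_trans G2n) // up_logP //.
- by move=> x y /mem_take; rewrite mem_enum => xQ /mem_take; rewrite mem_enum => yQ; apply: Qr.
Qed.

Lemma arrows_joined (G1 G2 : sgraph) (U1 : {set G1}) (U2 : {set G2}) (d n : nat) :
  0 < n -> #|G1| <= n -> #|G2| <= n ->
  max_degree (del_vertices U1) <= d -> max_degree (del_vertices U2) <= d ->
  arrows G1 G2 (2 ^ (#|U1| + #|U2|) * embed_or_clique_bound d n).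
Proof.
move=> n0 G1n G2n deg1 deg2; have M0 := embed_or_clique_bound_gt0 d n0.
apply/forallP => c.
have cov x y : x != y -> color_edge c true x y || color_edge c false x y.
  by rewrite /color_edge => ->; case: (c _).
have [|J|J] := monochromatic_joined_clique (S := setT)
  (@color_edge_sym _ c true) (@color_edge_sym _ c false)
  (@color_edge_irrefl _ c true) (@color_edge_irrefl _ c false)
  cov M0 (a := #|U1|) (b := #|U2|).
- by rewrite cardsT card_ord.
- exact: contains_copy_of_joined_clique J.
- rewrite orbC; apply: contains_copy_of_joined_clique J => // x y.
  by rewrite orbC; apply: cov.
Qed.

(** * The order of the host graph *)

Import Order.TTheory GRing.Theory Num.Theory.
Local Open Scope ring_scope.

(** The exponent of 2 is at most u1 + u2 + t (t + 1) d + 2 t.  The first two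
    terms are at most 54 k.  From ln x <= x - 1 and ln 2 >= 1 / 2 one gets
    L <= 6 k, so 2 t <= 14 k.  For n >= 4, L >= 2 and
    t (t + 1) d <= (L + 1) (L + 2) * 54 k / L ^ 3 <= 162 k / L <= 81 k.  For
    n <= 3, where L may be as small as 1, d <= n gives the same bound 81 k. *)
Lemma embed_or_clique_bound_powR (R : realType) (n u1 u2 d : nat) :
  (2 <= n)%N -> (d <= n)%N ->
  u1%:R <= 27 * cbrt (n%:R : R) -> u2%:R <= 27 * cbrt (n%:R : R) ->
  d%:R <= 54 * (cbrt (n%:R : R) / log2 (n%:R : R) ^+ 3) ->
  (2 ^ (u1 + u2) * embed_or_clique_bound d n)%:R
     <= (2 : R) `^ (250 * cbrt (n%:R : R)).
Proof.
move=> n2 dn hu1 hu2 hd.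
set t := up_log 2 n.
set k := cbrt _ in hu1 hu2 hd *; set L := log2 _ in hd *.
pose E := (u1 + u2 + ((t * d + d).+1 * t + t))%N.
have natE : (2 ^ (u1 + u2) * embed_or_clique_bound d n <= 2 ^ E)%N.
  rewrite [(2 ^ E)%N]expnD leq_mul // expnD expnM leq_mul ?up_logP //.
  have base : (2 * (2 ^ (t * d) * d.+1) <= 2 ^ (t * d + d).+1)%N.
    by rewrite expnS leq_mul2l /= expnD leq_mul2l ltn_expl // orbT.
  by rewrite leq_exp2r // up_log_gt0.
suff hE : E%:R <= 250 * k.
  apply: le_trans (ler_powR _ hE); last by lra.
  by rewrite powR_mulrn ?ler0n // -natrX ler_nat.
have n0 : 0 < n%:R :> R by rewrite ltr0n; lia.
have k1 : 1 <= k.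
  rewrite -(powRr0 n%:R) /k /cbrt ler_powR // ?invr_ge0 ?ler0n //.
  by rewrite ler1n; lia.
have lnk : ln n%:R = 3 * ln k :> R.
  by rewrite /k /cbrt ln_powR mulrA mulfV ?mul1r ?pnatr_eq0.
have lnk_le : ln k <= k - 1.
  by rewrite -{1}[k](addrNK 1) addrC le_ln1Dx; lra.
have ln2_ge : 1 / 2 <= ln 2 :> R.
  have := @le_ln1Dx R (- (1 / 2)).
  rewrite (_ : 1 + - (1 / 2) = 2^-1 :> R); last by lra.
  rewrite lnV ?posrE ?ltr0n // => h; have := h ltac:(lra); lra.
have ln2_gt0 : 0 < ln 2 :> R by lra.
have Lln : L * ln 2 = ln n%:R by rewrite /L /log2 divfK // gt_eqF.
have L6k : L <= 6 * k by nra.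
have powL m : (2 ^ m <= n)%N -> m%:R <= L.
  move=> mn; rewrite -(ler_pM2r ln2_gt0) Lln mulr_natl -lnXn ?ltr0n //.
  by rewrite ler_ln ?posrE ?exprn_gt0 // -natrX ler_nat.
have tL : t%:R <= L + 1.
  have t0 : (0 < t)%N by rewrite up_log_gt0.
  rewrite -(prednK t0) -natr1 lerD2r powL // ltnW //.
  exact: up_log_gtn.
have EE : E%:R = u1%:R + u2%:R + (t * t.+1 * d)%:R + t%:R + t%:R :> R.
  by rewrite -!natrD; congr (_%:R); rewrite /E; nia.
have main : (t * t.+1 * d)%:R <= 81 * k.
  have [n4|n3] := leqP 4 n; last first.
    have t2 : (t <= 2)%N by apply: up_log_min => //; lia.
    have le18 : (t * t.+1 * d <= 18)%N.
      by apply: (@leq_trans (2 * 3 * 3)) => //; rewrite !leq_mul //; lia.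
    by move: le18; rewrite -(ler_nat R) => le18; lra.
  have L2 : 2 <= L by apply: (powL 2).
  have tt : (t * t.+1)%:R <= 3 * L ^+ 2.
    by rewrite natrM -natr1; have := ler0n R t; nra.
  have d0 := ler0n R d.
  have L0 : 0 < L by lra.
  rewrite natrM.
  apply: (@le_trans _ _ (3 * L ^+ 2 * (54 * (k / L ^+ 3)))).
    by apply: ler_pM.
  rewrite (_ : _ * _ = 162 * k / L); last by field; lra.
  rewrite ler_pdivrMr //; nra.
rewrite EE; lra.
Qed.

Theorem corollary1p7 (R : realType) (G1 G2 : sgraph) (n1 n2 n : nat)
  (order1 : #|G1| = n1) (order2 : #|G2| = n2)
  (n_max : n = maxn n1 n2) (n_ge2 : (2 <= n)%N)
  (U1_ex : exists U1 : {set G1},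
     (#|U1|)%:R <= 27 * cbrt (n%:R : R) /\
     (max_degree (del_vertices U1))%:R
       <= 54 * (cbrt (n%:R : R) / log2 (n%:R : R) ^+ 3))
  (U2_ex : exists U2 : {set G2},
     (#|U2|)%:R <= 27 * cbrt (n%:R : R) /\
     (max_degree (del_vertices U2))%:R
       <= 54 * (cbrt (n%:R : R) / log2 (n%:R : R) ^+ 3)) :
  (ramsey_number G1 G2)%:R <= (2 : R) `^ (250 * cbrt (n%:R : R)).
Proof.
have [U1 [cU1 dU1]] := U1_ex; have [U2 [cU2 dU2]] := U2_ex.
have G1n : (#|G1| <= n)%N by rewrite order1 n_max leq_maxl.
have G2n : (#|G2| <= n)%N by rewrite order2 n_max leq_maxr.
have degn (G : sgraph) (U : {set G}) : (#|G| <= n)%N -> (max_degree (del_vertices U) <= n)%N.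
  move=> Gn; apply/bigmax_leqP => x _.
  by rewrite (leq_trans (max_card _)) // card_sub (leq_trans (max_card _)).
set d1 := max_degree _ in dU1; set d2 := max_degree _ in dU2.
pose d := maxn d1 d2.
have dn : (d <= n)%N by rewrite geq_max !degn.
have hd : d%:R <= 54 * (cbrt (n%:R : R) / log2 (n%:R : R) ^+ 3).
  by rewrite /d; case: leqP.
have n0 : (0 < n)%N by lia.
apply: le_trans (embed_or_clique_bound_powR n_ge2 dn cU1 cU2 hd).
rewrite ler_nat /ramsey_number; case: ex_minnP => N _; apply.
rewrite (@arrows_joined G1 G2 U1 U2 d n) ?leq_maxl ?leq_maxr //.
by rewrite muln_gt0 expn_gt0 embed_or_clique_bound_gt0.
Qed.
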